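(* For every complex number $q$ with $|q|<1$, $$\sum_{n=0}^{\infty} \sigma_{e}\mathrm{Mex}(n)\,q^{n} = \frac{1}{(q;q)_{\infty}} \sum_{j=0}^{\infty} j \, 2^{2j} q^{\binom{2j}{2}} (-q^{2j+1};q)_{\infty} \, (1 - q^{2j}).$$
   Context: An overpartition of a non-negative integer $n$ is a partition of $n$ (a finite non-increasing sequence of positive integers with sum $n$) in which the first occurrence of each distinct part may or may not be overlined; the empty overpartition is the only overpartition of $0$. Let $\bar{P}(n)$ be the set of all overpartitions of $n$. For $\lambda\in\bar P(n)$, $\mathrm{Mex}(\lambda)$ is the smallest positive integer that does not occur as a part of $\lambda$, whether overlined or non-overlined (so $\mathrm{Mex}$ of the empty overpartition is $1$). Let $\mathrm{Mex}_e(\lambda)=\mathrm{Mex}(\lambda)$ if $\mathrm{Mex}(\lambda)$ is even, and $\mathrm{Mex}_e(\lambda)=0$ otherwise. Define $\sigma_e\mathrm{Mex}(n)=\sum_{\lambda\in\bar P(n)}\mathrm{Mex}_e(\lambda)$. For complex $a,q$ with $|q|<1$, $(a;q)_\infty=\prod_{k=0}^{\infty}(1-aq^k)$. Here $\binom{m}{2}=m(m-1)/2$ and $q^0=1$. *)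

(* Defs.v *)
From mathcomp Require Import all_boot all_order all_algebra.
From mathcomp Require Import all_classical all_reals all_analysis.

Set Implicit Arguments.
Unset Strict Implicit.
Unset Printing Implicit Defensive.

Import Order.TTheory GRing.Theory Num.Theory.
Import numFieldNormedType.Exports.

Local Open Scope classical_set_scope.
Local Open Scope ring_scope.

(* An entry (k, b) is an occurrence of the part k, overlined iff b = true.
   The pairwise condition says that an overlined entry differs, as a part, from
   all the earlier ones, i.e. is the first occurrence of its part. *)
Definition is_overpartition (n : nat) (s : seq (nat * bool)) : bool :=
  [&& sorted geq (unzip1 s),
      all (ltn 0) (unzip1 s),
      pairwise (fun x y : nat * bool => y.2 ==> (x.1 != y.1)) s
    & sumn (unzip1 s) == n].

Definition overpartitions (n : nat) : set (seq (nat * bool)) :=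
  [set s | is_overpartition n s].

Lemma leq_sumn (u : seq nat) (m : nat) : m \in u -> (m <= sumn u)%N.
Proof.
elim: u => //= a u IHu; rewrite inE => /orP[/eqP->|/IHu h].
  exact: leq_addr.
exact: leq_trans h (leq_addl _ _).
Qed.

Lemma exists_mex (s : seq (nat * bool)) :
  exists m, (0 < m)%N && (m \notin unzip1 s).
Proof.
exists (sumn (unzip1 s)).+1 => /=.
by apply/negP => /leq_sumn; rewrite ltnn.
Qed.

Definition Mex (s : seq (nat * bool)) : nat := ex_minn (exists_mex s).

Definition Mex_e (s : seq (nat * bool)) : nat :=
  if odd (Mex s) then 0%N else Mex s.

(* Sums over a set with infinite support are 0 by convention in fsbigop; the
   lemma excludes this case. *)
Lemma finite_overpartitions (n : nat) : finite_set (overpartitions n).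
Proof.
pose h (w : {bseq n of 'I_n.+1 * bool}) : seq (nat * bool) :=
  [seq (val x.1, x.2) | x <- w].
apply: (@sub_finite_set _ _ (h @` setT)); last first.
  exact: finite_image.
move=> s /and4P[_ s0 _ /eqP sn].
have szs : (size s <= n)%N.
  rewrite -sn -(size_map fst s) -/(unzip1 s).
  by elim: (unzip1 s) s0 => //= k t IHt /andP[k0 /IHt h']; rewrite -add1n leq_add.
have les x : x \in s -> (x.1 <= n)%N.
  by move=> xs; rewrite -sn; apply/leq_sumn/map_f.
have szt : (size [seq (inord x.1 : 'I_n.+1, x.2) | x <- s] <= n)%N.
  by rewrite size_map.
exists (Bseq szt) => //; rewrite /h /= -map_comp -[RHS]map_id.
apply/eq_in_map => -[k b] xs /=; rewrite inordK// ltnS.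
exact: (les _ xs).
Qed.

Definition sigma_eMex (n : nat) : nat :=
  \big[addn/0%N]_(s \in overpartitions n) Mex_e s.

(* The library has no topology on R[i]; the notions below are stated over an
   arbitrary numFieldType K with the topology of its norm, so that they apply
   to K := R[i]. *)
Definition series_cvg (K : numFieldType) (u : nat -> K) : Prop :=
  cvgn (series u).

Definition series_sum (K : numFieldType) (u : nat -> K) : K :=
  limn (series u).

Definition qPochhammer_part (K : numFieldType) (a q : K) (n : nat) : K :=
  \prod_(k < n) (1 - a * q ^+ k).

Definition qPochhammer_cvg (K : numFieldType) (a q : K) : Prop :=
  cvgn (qPochhammer_part a q).

(* (a; q)_oo *)
Definition qPochhammer (K : numFieldType) (a q : K) : K :=
  limn (qPochhammer_part a q).

(* Main.v *)
Require Import Defs.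
From mathcomp Require Import all_boot all_order all_algebra.
From mathcomp Require Import complex.
From mathcomp Require Import all_classical all_reals all_analysis.
From mathcomp Require Import ring.
Import Order.TTheory GRing.Theory Num.Theory.
Import numFieldNormedType.Exports.
Local Open Scope ring_scope.

(* An overpartition with [Mex = 2j] contains every part [k < 2j] at least once,
   avoids [2j], and is arbitrary on the parts [k > 2j].  As a part [k] has
   generating function [(1 + q^k) / (1 - q^k)], these overpartitions contribute
   [prod_(k < 2j) 2q^k / (1 - q^k) * prod_(k > 2j) (1 + q^k) / (1 - q^k)],
   which times [2j] is the [j]-th term of the right-hand side.
   To make this analytic, bound the parts by [N] and the multiplicities by [M]:
   the sum over overpartitions becomes a polynomial that factors exactly. All
   coefficients being nonnegative, its distance at [q] to a partial sum of the
   left-hand side is at most the same difference at [|q|]; letting [M], then [N]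
   tend to infinity reduces everything to [0 <= q < 1], where monotonicity
   concludes. *)

(** * Overpartitions as sorted lists, and the mex *)

Local Open Scope nat_scope.

(** Larger parts come first and, among equal parts, the overlined copy. Sorting by this order gives
    a multiset of entries a unique listing. *)
Definition over_le (x y : nat * bool) : bool :=
  (y.1 < x.1)%N || ((x.1 == y.1) && (y.2 ==> x.2)).

Lemma over_le_trans : transitive over_le.
Proof.
move=> [y b] [x a] [z c]; rewrite /over_le /=.
case/orP => [yx|/andP[/eqP-> ba]] /orP[zy|/andP[/eqP<- cb]].
- by rewrite (ltn_trans zy yx).
- by rewrite yx.
- by rewrite zy.
- by rewrite eqxx ltnn /=; apply/implyP => /(implyP cb)/(implyP ba).
Qed.

Lemma over_le_anti : antisymmetric over_le.
Proof.
move=> [x a] [y b]; rewrite /over_le /=.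
case: (ssrnat.ltngtP y x) => //= [->]; case: a; case: b => //.
Qed.

Lemma over_le_total : total over_le.
Proof.
move=> [x a] [y b]; rewrite /over_le /=.
case: (ssrnat.ltngtP y x) => //= _; by case: a; case: b.
Qed.

(** An overlined entry differs from all earlier parts, so among equal parts it can only come
    first. *)
Lemma overpartition_sorted n s : is_overpartition n s -> sorted over_le s.
Proof.
case/and4P => so _ pw _; rewrite (sorted_pairwise over_le_trans).
move: so; rewrite sorted_pairwise; last exact/rev_trans/leq_trans.
rewrite /unzip1 pairwise_map => so.
have := pairwise_relI (relpre fst geq)
  (fun x y : nat * bool => y.2 ==> (x.1 != y.1)) s.
rewrite so pw /= => pI; apply: sub_pairwise pI => x y /= /andP[].
rewrite /over_le leq_eqVlt; case: y x => [y b] [x a] /=.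
by case: (ssrnat.ltngtP y x) => //= _ _; case: b.
Qed.

Lemma overpartition_count1 n s k :
  is_overpartition n s -> (count_mem (k, true) s <= 1)%N.
Proof.
case/and4P => _ _ pw _; elim: s pw => //= x s IHs /andP[/allP hx /IHs h].
case: eqP => [xE|_]; last exact: h.
rewrite addnC addn1 ltnS leqn0; apply/eqP/count_memPn/negP => /hx.
by rewrite xE /= eqxx.
Qed.

(** If an overlined entry had an earlier equal part, the order would force that earlier entry to be
    overlined too, against the bound on the count. *)
Lemma sorted_overpartition s :
  sorted over_le s -> (forall k, count_mem (k, true) s <= 1)%N ->
  all (ltn 0) (unzip1 s) -> is_overpartition (sumn (unzip1 s)) s.
Proof.
rewrite (sorted_pairwise over_le_trans) => so c1 pos.
rewrite /is_overpartition pos eqxx /= andbT; apply/andP; split.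
  rewrite sorted_pairwise; last exact/rev_trans/leq_trans.
  rewrite /unzip1 pairwise_map; apply: sub_pairwise so => x y /=.
  by rewrite /over_le => /orP[/ltnW|/andP[/eqP-> _]].
elim: s so c1 {pos} => //= x s IHs /andP[/allP hx /IHs h] c1.
rewrite h; last first.
  by move=> k; apply: leq_trans (c1 k); rewrite leq_addl.
rewrite andbT; apply/allP => -[k []] // ys /=; apply/negP => /eqP xk.
have := hx _ ys; rewrite /over_le /= xk ltnn eqxx /= => x2.
have := c1 k; rewrite [x]surjective_pairing xk x2 eqxx /=.
by rewrite addnC addn1 ltnS leqn0 => /eqP/count_memPn; rewrite ys.
Qed.

Lemma MexP s i :
  reflect [/\ (0 < i)%N, i \notin unzip1 s &
             forall m, (0 < m < i)%N -> m \in unzip1 s] (Mex s == i).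
Proof.
rewrite /Mex; case: ex_minnP => m /andP[m0 ms] mmin.
apply: (iffP eqP) => [<-|[i0 ins all_in]].
  split=> // k /andP[k0 km]; apply/negPn/negP => ks.
  by have := mmin k; rewrite k0 ks /= => /(_ isT); rewrite leqNgt km.
apply/eqP; rewrite eqn_leq mmin ?i0 //= leqNgt; apply/negP => mi.
by have := all_in m; rewrite m0 mi (negbTE ms) => /(_ isT).
Qed.

Lemma Mex_leq_succ_sum s : (Mex s <= (sumn (unzip1 s)).+1)%N.
Proof.
rewrite /Mex; case: ex_minnP => m _; apply => /=.
by apply/negP => /leq_sumn; rewrite ltnn.
Qed.

(** * Profiles with bounded parts and multiplicities *)

(* [f k = (a, b)] encodes that the part [k + 1] occurs [a + b] times, [a] of
   these occurrences being overlined: overpartitions with parts at most [N] are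
   exactly the unconstrained choices of such pairs. *)
Section Profiles.
Variables N M : nat.

Definition profile := {ffun 'I_N -> bool * 'I_M.+1}.

Implicit Type f : profile.

Definition psize f : nat := \sum_(k < N) k.+1 * ((f k).1 + (f k).2).

Definition blocks f : seq (nat * bool) :=
  flatten [seq nseq (f k).1 (k.+1, true) ++ nseq (f k).2 (k.+1, false)
          | k : 'I_N <- enum 'I_N].

Definition overpartition_of f : seq (nat * bool) := sort over_le (blocks f).

Lemma perm_blocks f : perm_eq (overpartition_of f) (blocks f).
Proof. by rewrite perm_sort. Qed.

Lemma count_blocks f (k : 'I_N) b :
  count_mem (k.+1, b) (blocks f) = if b then (f k).1 : nat else (f k).2.
Proof.
rewrite /blocks count_flatten -map_comp sumnE big_map big_enum /=.
rewrite (bigD1 k) //= big1 ?addn0.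
  rewrite count_cat !count_nseq /= !xpair_eqE !eqxx /=.
  by case: b; rewrite /= ?mul1n ?mul0n ?addn0 ?add0n.
move=> i ik; rewrite count_cat !count_nseq /= !xpair_eqE !eqSS.
by rewrite -(inj_eq val_inj) in ik; rewrite (negbTE ik).
Qed.

Lemma count_overpartition_of f (k : 'I_N) b :
  count_mem (k.+1, b) (overpartition_of f) =
  if b then (f k).1 : nat else (f k).2.
Proof. by rewrite (permP (perm_blocks f)) count_blocks. Qed.

Lemma mem_overpartition_of f m b :
  (m, b) \in overpartition_of f -> exists k : 'I_N, m = k.+1.
Proof.
rewrite (perm_mem (perm_blocks f)) => /flattenP[s /mapP[k _ ->]].
rewrite mem_cat !mem_nseq => /orP[] /andP[_ /eqP[-> _]]; by exists k.
Qed.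

Lemma mem_parts_overpartition_of f (k : 'I_N) :
  (k.+1 \in unzip1 (overpartition_of f)) = (f k != (false, ord0)).
Proof.
have c b := count_overpartition_of f k b.
apply/idP/idP.
  case/mapP=> -[m b] ms /= km; rewrite -km in ms.
  have: (0 < count_mem (k.+1, b) (overpartition_of f))%N.
    by rewrite -has_count has_pred1.
  by rewrite c; case: (f k) => [[] v]; case: b {ms} => //= v0;
    apply/eqP => -[ve]; rewrite ve in v0.
move=> fk; apply/mapP.
have [b cb] : exists b, (0 < count_mem (k.+1, b) (overpartition_of f))%N.
  case E: (f k) fk => [[] v].
    by exists true; rewrite c E.
  rewrite xpair_eqE /= -(inj_eq val_inj) /= -lt0n => v0.
  by exists false; rewrite c E.
by exists (k.+1, b) => //; rewrite -has_pred1 has_count.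
Qed.

Lemma sumn_overpartition_of f : sumn (unzip1 (overpartition_of f)) = psize f.
Proof.
rewrite (perm_sumn (perm_map fst (perm_blocks f))) /blocks map_flatten.
rewrite sumn_flatten -!map_comp sumnE big_map /=.
rewrite -enumT big_enum /=; apply: eq_bigr => k _.
by rewrite map_cat sumn_cat !map_nseq !sumn_nseq mulnDr.
Qed.

Lemma overpartition_ofP f : is_overpartition (psize f) (overpartition_of f).
Proof.
rewrite -sumn_overpartition_of; apply: sorted_overpartition.
- exact: sort_sorted over_le_total _.
- move=> m; case: (boolP ((m, true) \in overpartition_of f)) => [ms|].
    have [k mk] := mem_overpartition_of _ _ _ ms.
    by rewrite mk count_overpartition_of; case: (f k).1.
  by move/count_memPn => ->.
- apply/allP => m /mapP[[m' b] /mem_overpartition_of[k /= ->] ->] /=.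
  by [].
Qed.

Lemma overpartition_of_inj : injective overpartition_of.
Proof.
move=> f g fg; apply/ffunP => k.
have c b : (if b then (f k).1 : nat else (f k).2) =
           (if b then (g k).1 : nat else (g k).2).
  by rewrite -!count_overpartition_of fg.
have := c true; have := c false => /=.
by case: (f k) (g k) => [[] v] [[] w] //= /val_inj ->.
Qed.

(** Parts and multiplicities in an overpartition of [n] are at most [n], so the counts in [s] fit
    into a profile; two sorted lists with equal counts coincide. *)
Lemma overpartition_of_surj n s : (n <= N)%N -> (n <= M)%N ->
  is_overpartition n s -> exists2 f, psize f = n & overpartition_of f = s.
Proof.
move=> nN nM os; pose f : profile := [ffun k : 'I_N =>
  ((k.+1, true) \in s, inord (count_mem (k.+1, false) s))].
have [_ pos _ /eqP sn] := and4P os.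
have parts m b : (m, b) \in s -> (0 < m <= n)%N.
  move=> /(map_f fst) /= ms; rewrite -sn leq_sumn // andbT.
  exact: (allP pos).
have mult : (size s <= n)%N.
  rewrite -sn -(size_map fst s) -/(unzip1 s).
  elim: (unzip1 s) pos => //= k t IHt /andP[k0 /IHt h'].
  by rewrite -add1n leq_add.
have fs : overpartition_of f = s.
  apply: (sorted_eq over_le_trans over_le_anti).
  - exact: sort_sorted over_le_total _.
  - exact: overpartition_sorted os.
  apply/allP => -[m b] _ /=; apply/eqP.
  case: (boolP (0 < m <= N)%N) => [/andP[m0 mN]|mo].
    have lt : (m.-1 < N)%N by rewrite prednK.
    have mE : m = (Ordinal lt).+1 by rewrite /= prednK.
    rewrite mE count_overpartition_of ffunE -mE; case: b => /=.
      have := overpartition_count1 _ _ m os.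
      rewrite -has_pred1 has_count; by case: count => [|[]].
    by rewrite inordK // ltnS (leq_trans (count_size _ _)) ?(leq_trans mult).
  (* Outside [1, ..., N] both counts vanish. *)
  rewrite (count_memPn _); last first.
    apply: contra mo => /mem_overpartition_of[k ->] //=.
  rewrite (count_memPn _) //; apply: contra mo => /parts /andP[-> /=].
  by move/leq_trans; apply.
by exists f => //; rewrite -sumn_overpartition_of fs.
Qed.

(* Factor at the part [k + 1] of the indicator of [Mex = i]. *)
Definition mex_ok (i k : nat) (v : bool * 'I_M.+1) : bool :=
  if (k.+1 < i)%N then v != (false, ord0)
  else if k.+1 == i then v == (false, ord0) else true.

(** This is [Mex_e], cut to 0 when the mex exceeds [N], in a form where each summand is a product
    over parts, so that the sum over profiles can factor. *)
Definition mex_weight f : nat :=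
  \sum_(j < N.+1 | (2 * j <= N)%N)
     2 * j * \prod_(k < N) (mex_ok (2 * j) k (f k) : nat).

Lemma prod_mex_ok f i : (0 < i <= N)%N ->
  \prod_(k < N) (mex_ok i k (f k) : nat) = (Mex (overpartition_of f) == i).
Proof.
case/andP => i0 iN.
transitivity (nat_of_bool [forall k : 'I_N, mex_ok i k (f k)]).
  case: forallP => [h|/forallP]; first by rewrite big1 // => k _; rewrite h.
  by rewrite negb_forall => /existsP[k /negbTE kE]; rewrite (bigD1 k) //= kE.
congr nat_of_bool; apply/forallP/MexP => [h|[_ ins all_in] k].
  split=> //.
    have lt : (i.-1 < N)%N by rewrite prednK.
    have := h (Ordinal lt); rewrite /mex_ok /= prednK // ltnn eqxx => fk.
    have := mem_parts_overpartition_of f (Ordinal lt).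
    by rewrite /= prednK // => ->; rewrite negbK.
  move=> m /andP[m0 mi].
  have lt : (m.-1 < N)%N by rewrite prednK // (leq_trans (ltnW mi)).
  have := h (Ordinal lt); rewrite /mex_ok /= prednK // mi => fk.
  have := mem_parts_overpartition_of f (Ordinal lt).
  by rewrite /= prednK // => ->.
rewrite /mex_ok; case: ifP => ki.
  by rewrite -mem_parts_overpartition_of all_in.
case: eqP => // kE.
by rewrite -kE mem_parts_overpartition_of negbK in ins.
Qed.

Lemma mex_weightE f : mex_weight f =
  if (Mex (overpartition_of f) <= N)%N then Mex_e (overpartition_of f) else 0%N.
Proof.
set s := overpartition_of f.
have s0 : (0 < Mex s)%N by have /MexP[] := eqxx (Mex s).
rewrite /mex_weight.
have termE (j : 'I_N.+1) : (2 * j <= N)%N ->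
    2 * j * \prod_(k < N) (mex_ok (2 * j) k (f k) : nat) =
    if Mex s == 2 * j then Mex s else 0.
  (* At [j = 0] every [mex_ok] test passes, but the coefficient [2 * j] kills the term. *)
  case: (posnP j) => [->|j0] jN.
    by rewrite muln0 mul0n; case: eqP => // ->.
  rewrite prod_mex_ok ?muln_gt0 ?j0 //.
  by case: eqP => [->|]; rewrite ?muln1 ?muln0.
rewrite (eq_bigr _ termE) /Mex_e.
case: ifP => sN; last first.
  rewrite big1 // => j jN; case: eqP => // sj.
  by rewrite sj jN in sN.
case: ifP => so.
  rewrite big1 // => j _; case: eqP => // sj.
  by rewrite sj mul2n odd_double in so.
have sE : Mex s = 2 * (Mex s)./2.
  by rewrite mul2n -[LHS]odd_double_half so.
have lt : ((Mex s)./2 < N.+1)%N.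
  by rewrite ltnS (leq_trans _ sN) // [leqRHS]sE leq_pmull.
rewrite (bigD1 (Ordinal lt)) /= -?sE // eqxx big1 ?addn0 // => j /andP[jN jn].
case: eqP => // sj; case/eqP: jn; apply: val_inj => /=.
by rewrite sj mul2n doubleK.
Qed.

Definition mex_coef n : nat := \sum_(f : profile | psize f == n) mex_weight f.

Definition overpartition_seq n :=
  [seq overpartition_of f | f <- enum [pred f | psize f == n]].

Lemma overpartition_seq_uniq n : uniq (overpartition_seq n).
Proof. by rewrite map_inj_uniq ?enum_uniq //; exact: overpartition_of_inj. Qed.

Lemma overpartition_seq_sub n s :
  s \in overpartition_seq n -> is_overpartition n s.
Proof.
case/mapP => f; rewrite mem_enum inE => /eqP <- ->; exact: overpartition_ofP.
Qed.

(** Profiles of size [n] inject into the overpartitions of [n], and [mex_weight] never exceeds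
    [Mex_e]. *)
Lemma mex_coef_le n : (mex_coef n <= sigma_eMex n)%N.
Proof.
rewrite /sigma_eMex fsbig_finite /=; last exact: finite_overpartitions.
apply: (@leq_trans (\sum_(s <- overpartition_seq n) Mex_e s)).
  rewrite /mex_coef big_map big_enum /=.
  by apply: leq_sum => f _; rewrite mex_weightE; case: ifP.
apply: uniq_sub_le_big => //.
- by move=> *; exact: leq_addr.
- exact: overpartition_seq_uniq.
- exact: finmap.fset_uniq.
- move=> s /overpartition_seq_sub os; rewrite in_fset_set ?inE //.
  exact: finite_overpartitions.
Qed.

(** Every overpartition of [n] now comes from a profile. The strict bound [n < N] ensures
    [Mex <= n + 1 <= N], so no weight is cut. *)
Lemma mex_coefE n : (n < N)%N -> (n <= M)%N -> mex_coef n = sigma_eMex n.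
Proof.
move=> nN nM; rewrite /sigma_eMex (fsbigE (overpartition_seq n)) /=; last 3 first.
- exact: overpartition_seq_uniq.
- by move=> s /overpartition_seq_sub.
- move=> s os; have [f fn <-] := overpartition_of_surj _ _ (ltnW nN) nM os.
  by case/negP; apply/map_f; rewrite mem_enum inE fn.
rewrite /mex_coef big_map big_enum_cond /=.
rewrite [RHS](eq_bigl (fun f => psize f == n)); last first.
  move=> f; rewrite inE andb_idr // => /eqP fn; apply/mem_set.
  by have := overpartition_ofP f; rewrite fn.
apply: eq_bigr => f /eqP fn; rewrite mex_weightE ifT //.
by rewrite (leq_trans (Mex_leq_succ_sum _)) // sumn_overpartition_of fn.
Qed.

Definition mex_poly (K : comNzRingType) (x : K) : K :=
  (\sum_(f : profile) (mex_weight f)%:R * x ^+ psize f)%R.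

(** For fixed [j], both the indicator and [x ^+ psize f] are products over parts, so the sum over
    all functions [f] distributes into a product of sums over single values. *)
Lemma mex_polyE (K : comNzRingType) (x : K) : mex_poly K x =
  (\sum_(j < N.+1 | (2 * j <= N)%N) (2 * j)%:R * \prod_(k < N)
    \sum_(v : bool * 'I_M.+1 | mex_ok (2 * j) k v) x ^+ (k.+1 * (v.1 + v.2)))%R.
Proof.
rewrite /mex_poly /mex_weight.
under eq_bigr do rewrite natr_sum mulr_suml.
rewrite exchange_big /=; apply: eq_bigr => j _.
under [in RHS]eq_bigr do rewrite big_mkcond.
rewrite bigA_distr_bigA /= mulr_sumr; apply: eq_bigr => f _.
rewrite natrM -mulrA natr_prod /psize; congr (_ * _)%R.
rewrite expr_sum -big_split /=; apply: eq_bigr => k _.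
by case: ifP; rewrite ?mul1r ?mul0r.
Qed.

End Profiles.

Local Open Scope ring_scope.

Local Open Scope classical_set_scope.


(** * The truncated polynomial against partial sums of the series *)

Section ProfileSums.
Variables (N M : nat) (K : numFieldType).
Implicit Types x y : K.

Lemma mex_poly_lt x D :
  \sum_(f : profile N M | (psize N M f < D)%N)
     (mex_weight N M f)%:R * x ^+ psize N M f =
  \sum_(0 <= n < D) (mex_coef N M n)%:R * x ^+ n.
Proof.
rewrite big_mkord.
under [RHS]eq_bigr => n _.
  rewrite /mex_coef natr_sum mulr_suml.
  rewrite (eq_bigr (fun f => (mex_weight N M f)%:R * x ^+ psize N M f)); last first.
    by move=> f /eqP ->.
  over.
rewrite (exchange_big_dep (fun f => psize N M f < D)%N) /=; last first.
  by move=> n f _ /eqP ->.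
apply: eq_bigr => f fD.
by rewrite (big_pred1 (Ordinal fD)) // => n; rewrite eq_sym.
Qed.

(** Coefficients below degree [D] are exact, so only profiles of size at least [D] remain; their
    weights are nonnegative and the triangle inequality applies. *)
Lemma mex_poly_dist x D : (D <= N)%N -> (D <= M)%N ->
  `|mex_poly N M K x - series (fun n => (sigma_eMex n)%:R * x ^+ n) D| <=
  mex_poly N M K `|x| - series (fun n => (sigma_eMex n)%:R * `|x| ^+ n) D.
Proof.
move=> DN DM.
have tailE y : mex_poly N M K y - series (fun n => (sigma_eMex n)%:R * y ^+ n) D =
    \sum_(f : profile N M | ~~ (psize N M f < D)%N)
     (mex_weight N M f)%:R * y ^+ psize N M f.
  rewrite /mex_poly (bigID (fun f => psize N M f < D)%N) /= mex_poly_lt.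
  rewrite /series /= addrAC; set s := (X in X + _).
  suff -> : s = 0 by rewrite add0r.
  apply/eqP; rewrite subr_eq0; apply/eqP; apply: eq_big_nat => n /andP[_ nD].
  by rewrite mex_coefE ?(leq_trans nD) // ltnW // (leq_trans nD).
rewrite !tailE; apply: le_trans (ler_norm_sum _ _ _) _.
by apply: ler_sum => f _; rewrite normrM normrX normr_nat.
Qed.

Lemma mex_poly_le x : 0 <= x -> exists D,
  mex_poly N M K x <= series (fun n => (sigma_eMex n)%:R * x ^+ n) D.
Proof.
(* Beyond the degree of the polynomial, so that no profile is left out. *)
move=> x0; exists (\max_(f : profile N M) psize N M f).+1.
rewrite /mex_poly (eq_bigl (fun f => psize N M f < (\max_f psize N M f).+1)%N).
  rewrite mex_poly_lt; apply: ler_sum => n _.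
  by rewrite ler_wpM2r ?exprn_ge0 // ler_nat mex_coef_le.
by move=> f; rewrite ltnS leq_bigmax.
Qed.

Lemma sum_mex_ok x i k :
  \sum_(v : bool * 'I_M.+1 | mex_ok M i k v) x ^+ (k.+1 * (v.1 + v.2)) =
  let h := (1 + x ^+ k.+1) * \sum_(0 <= b < M.+1) (x ^+ k.+1) ^+ b in
  if (k.+1 < i)%N then h - 1 else if k.+1 == i then 1 else h.
Proof.
cbv zeta; set y := x ^+ k.+1; set h := (1 + y) * _.
have all : \sum_(v : bool * 'I_M.+1) x ^+ (k.+1 * (v.1 + v.2)) = h.
  under eq_bigr do rewrite exprM exprD.
  rewrite -(pair_bigA _ (fun (a : bool) (b : 'I_M.+1) => y ^+ a * y ^+ b)) /=.
  rewrite big_bool /= -!mulr_sumr -mulrDl expr0 expr1 [y + 1]addrC.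
  by rewrite /h big_mkord.
rewrite /mex_ok; case: ifP => _.
  (* Requiring the part removes the choice of multiplicity zero, which contributes 1. *)
  rewrite -all [in RHS](bigD1 (false, ord0)) //= addn0 muln0 expr0 [1 + _]addrC addrK.
  by apply: eq_bigl.
case: ifP => _; last by [].
by rewrite big_pred1_eq /= addn0 muln0.
Qed.

End ProfileSums.

(** * Limits and inequalities; completeness of the complex numbers *)

Lemma cvg_dist_le (K : numFieldType) (u v : nat -> K) (l : K) :
  v @ \oo --> 0 -> (forall n, `|l - u n| <= v n) -> u @ \oo --> l.
Proof.
move=> v0 uv; apply/cvgrPdist_le => e e0.
move/cvgrPdist_le: v0 => /(_ e e0); apply: filterS => n.
rewrite sub0r normrN; apply: le_trans.
by rewrite (le_trans (uv n)) // real_ler_norm // ger0_real // (le_trans _ (uv n)).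
Qed.

(** The order may be partial, as on [R[i]]. Since [u] equals its own norm, it also tends to the norm
    of [l], and limits are unique. *)
Lemma cvg_ge0 (K : numFieldType) (u : nat -> K) (l : K) :
  u @ \oo --> l -> (forall n, 0 <= u n) -> 0 <= l.
Proof.
move=> ul u0; suff -> : l = `|l| by [].
have ul' : u @ \oo --> `|l|.
  rewrite [X in X @ _](_ : u = fun n => `|u n|); first exact: cvg_norm.
  by apply/funext => n; rewrite ger0_norm.
exact: (cvg_unique (@norm_hausdorff _ K^o) ul ul').
Qed.

Lemma cvg_le (K : numFieldType) (u v : nat -> K) (l m : K) :
  u @ \oo --> l -> v @ \oo --> m -> (forall n, u n <= v n) -> l <= m.
Proof.
move=> ul vm uv; rewrite -subr_ge0.
by apply: (cvg_ge0 _ _ _ (cvgB vm ul)) => n /=; rewrite subr_ge0.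
Qed.

Lemma dist_majorized (K : numDomainType) (u v : nat -> K) :
  (forall n, `|u n.+1 - u n| <= v n.+1 - v n) ->
  forall m n, (m <= n)%N -> `|u n - u m| <= v n - v m.
Proof.
move=> uv m n /subnKC <-; elim: (n - m)%N => [|k IHk].
  by rewrite addn0 !subrr normr0.
rewrite addnS -[v _](subrK (v (m + k)%N)) -addrA.
rewrite -[u _](subrK (u (m + k)%N)) -addrA.
by apply: le_trans (ler_normD _ _) _; exact: lerD.
Qed.


(* A completeness property that does not mention the topology, so that it makes
   sense for [R[i]]: sequences whose increments are dominated by those of a
   bounded sequence converge. *)
Definition majorized_complete (K : numFieldType) : Prop :=
  forall (u v : nat -> K) (B : K),
    (forall n, `|u n.+1 - u n| <= v n.+1 - v n) -> (forall n, v n <= B) ->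
    exists l, forall e, 0 < e ->
      exists N, forall n, (N <= n)%N -> `|l - u n| <= e.

(* Adding the majorant makes a real sequence nondecreasing. *)
Lemma real_majorized_cvg (R : realType) (u v : nat -> R) (B : R) :
  (forall n, `|u n.+1 - u n| <= v n.+1 - v n) -> (forall n, v n <= B) ->
  cvgn u.
Proof.
move=> uv vB.
have vS n : v n <= v n.+1 by rewrite -subr_ge0 (le_trans _ (uv n)).
have cv : cvgn v.
  apply: nondecreasing_is_cvgn; first exact/nondecreasing_seqP.
  by exists B => _ [n _ <-].
have cuv : cvgn (u \+ v).
  apply: nondecreasing_is_cvgn.
    apply/nondecreasing_seqP => n /=.
    have := uv n; rewrite ler_norml => /andP[+ _].
    by rewrite -subr_ge0 opprK addrACA -opprD subr_ge0.
  exists ((B - v 0%N + u 0%N) + B) => _ [n _ <-] /=.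
  apply: lerD; last exact: vB.
  rewrite -lerBlDr; apply: le_trans (ler_norm _) _.
  apply: le_trans (dist_majorized _ _ _ uv _ _ (leq0n n)) _.
  by rewrite lerD2r.
rewrite [X in cvgn X](_ : u = (u \+ v) \- v); first exact: is_cvgB.
by apply/funext => n /=; rewrite addrK.
Qed.

(** The increments of the real and imaginary parts of [u] are both dominated by those of the real
    part of [v], which reduces to the real case. *)
Lemma complex_majorized_complete (R : realType) : majorized_complete R[i].
Proof.
move=> u v B uv vB.
have Re_le (x y : R[i]) : x <= y -> complex.Re x <= complex.Re y.
  by rewrite lecE => /andP[].
have normc_ge_Im (x : R[i]) : `|complex.Im x|%:C%C <= `|x|.
  have := normc_ge_Re ('i%C * x); rewrite normrM normCi mul1r.
  by case: x => x y /=; rewrite mul0r sub0r mul1r normrN.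
pose v' n := complex.Re (v n).
have vB' n : v' n <= complex.Re B by exact: Re_le.
have cRe : cvgn (fun n => complex.Re (u n)).
  apply: (real_majorized_cvg _ _ v' _ _ vB') => n.
  have := Re_le _ _ (le_trans (normc_ge_Re _) (uv n)).
  by rewrite !raddfB.
have cIm : cvgn (fun n => complex.Im (u n)).
  apply: (real_majorized_cvg _ _ v' _ _ vB') => n.
  have := Re_le _ _ (le_trans (normc_ge_Im _) (uv n)).
  by rewrite !raddfB.
pose a := limn (fun n => complex.Re (u n)).
pose b := limn (fun n => complex.Im (u n)).
exists (a +i* b)%C.
suff key (e : R[i]) : 0 < e ->
    exists N, forall n, (N <= n)%N -> `|(a +i* b)%C - u n| <= e.
  exact: key.
move=> e0.
(* A positive element of [R[i]] is real, so the tolerance can be split in two inside [R]. *)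
have er := RRe_real (gtr0_real e0).
have e20 : 0 < complex.Re e / 2.
  by rewrite divr_gt0 //; move: e0; rewrite ltcE => /andP[].
rewrite -er.
have /cvgrPdist_le/(_ _ e20) [N1 _ h1] := cRe.
have /cvgrPdist_le/(_ _ e20) [N2 _ h2] := cIm.
exists (maxn N1 N2) => n; rewrite geq_max => /andP[/h1 r1 /h2 r2].
have -> : (a +i* b)%C - u n =
    (a - complex.Re (u n))%:C%C + 'i%C * (b - complex.Im (u n))%:C%C.
  case: (u n) => c d; apply/eqP; rewrite eq_complex /=.
  by rewrite !(mul0r, subr0, add0r, addr0, mul1r, eqxx).
apply: le_trans (ler_normD _ _) _.
have normR (x : R) : `|x%:C%C| = `|x|%:C%C :> R[i].
  by rewrite normc_def /= expr0n /= addr0 sqrtr_sqr.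
rewrite normrM normCi mul1r !normR -rmorphD lecR.
by rewrite [leRHS](splitr (complex.Re e)) lerD.
Qed.

(** * Powers and dominated convergence *)

Section MajorizedComplete.
Variable K : numFieldType.
Hypothesis Kc : majorized_complete K.

Lemma majorized_cvg (u v : nat -> K) (B : K) :
  (forall n, `|u n.+1 - u n| <= v n.+1 - v n) -> (forall n, v n <= B) ->
  cvgn u.
Proof.
move=> uv vB; have [l ul] := Kc _ _ _ uv vB.
apply/cvg_ex; exists l; apply/cvgrPdist_le => e /ul[N hN].
by exists N.
Qed.

Lemma cvg_expn (x : K) : `|x| < 1 -> (fun n => x ^+ n) @ \oo --> (0 : K).
Proof.
move=> x1; apply: (@cvg_dist_le _ _ (fun n => `|x| ^+ n)); last first.
  by move=> n; rewrite sub0r normrN normrX.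
have r0 : 0 <= `|x| by [].
move: `|x| r0 x1 => r r0 r1.
have cr : cvgn (fun n => r ^+ n).
  (* The powers decrease, so their negatives serve as the majorant. The limit [l] then satisfies
     [r * l = l], which forces [l = 0]. *)
  apply: (@majorized_cvg _ (fun n => - r ^+ n) 0) => n; last first.
    by rewrite oppr_le0 exprn_ge0.
  rewrite opprK [leRHS]addrC distrC ger0_norm // subr_ge0.
  by rewrite exprS ler_piMl ?exprn_ge0 // ltW.
suff l0 : limn (fun n => r ^+ n) = 0 by rewrite -l0.
set l := limn _.
have rl : (fun n => r ^+ n.+1) @ \oo --> r * l.
  under eq_fun do rewrite exprS.
  by apply: cvgM cr; exact: cvg_cst.
have rl' : (fun n => r ^+ n.+1) @ \oo --> l.
  by rewrite (cvg_shiftS (fun n => r ^+ n)).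
have rlE : r * l = l := cvg_unique (@norm_hausdorff _ K^o) rl rl'.
have : (r - 1) * l == 0 by rewrite mulrBl mul1r rlE subrr.
by rewrite mulf_eq0 subr_eq0 (lt_eqF r1) => /eqP.
Qed.

(** Dominated convergence for series: past some [J] the tails of [a] and [l] are bounded by a small
    tail of [b], and the first [J] terms converge as a finite sum. *)
Lemma tannery (a : nat -> nat -> K) (l b : nat -> K) (B : K) :
  (forall N j, `|a N j| <= b j) -> (forall j, a^~ j @ \oo --> l j) ->
  (forall n, series b n <= B) ->
  cvgn (series l) /\
  (fun N => \sum_(j < N.+1) a N j) @ \oo --> limn (series l).
Proof.
move=> ab al bB.
have lb j : `|l j| <= b j.
  by apply: cvg_le (cvg_norm (al j)) (cvg_cst (b j)) _ => N; exact: ab.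
have b0 j : 0 <= b j by apply: le_trans (lb j).
have lS n : `|series l n.+1 - series l n| <= series b n.+1 - series b n.
  by rewrite !seriesSB.
have bS n : `|series b n.+1 - series b n| <= series b n.+1 - series b n.
  by rewrite !seriesSB ger0_norm.
have cl : cvgn (series l) := majorized_cvg _ _ _ lS bB.
have cb : cvgn (series b) := majorized_cvg _ _ _ bS bB.
split=> //; apply/cvgrPdist_le => e e0.
have e30 : 0 < e / 3 by rewrite divr_gt0.
have [J _ /(_ J (leqnn J)) /= bJ] := (cvgrPdist_le _ _).1 cb _ e30.
have lJ : `|limn (series l) - series l J| <= limn (series b) - series b J.
  apply: (@cvg_le _ (fun n => `|series l (n + J) - series l J|)
                 (fun n => series b (n + J) - series b J)).
  - apply: cvg_norm; apply: cvgB (cvg_cst _).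
    by rewrite (cvg_shiftn J (series l)).
  - by apply: cvgB (cvg_cst _); rewrite (cvg_shiftn J (series b)).
  - by move=> n; apply: dist_majorized => //; exact: leq_addl.
rewrite ger0_norm in bJ; last exact: le_trans lJ.
have aJ : (fun N => \sum_(0 <= j < J) a N j) @ \oo --> series l J.
  apply: cvg_big => //; exact: add_continuous.
near=> N.
have JN : (J <= N.+1)%N by apply: leqW; near: N; exact: nbhs_infty_ge.
have aN : `|\sum_(0 <= j < J) a N j - \sum_(j < N.+1) a N j| <= e / 3.
  rewrite distrC -(big_mkord xpredT) (big_cat_nat _ (n := J)) //= addrAC subrr.
  rewrite add0r; apply: le_trans (ler_norm_sum _ _ _) _.
  apply: le_trans (ler_sum _ (fun j _ => ab N j)) _.
  apply: le_trans bJ; rewrite lerBrDl /series /= -big_cat_nat //=.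
  apply: (@cvg_le _ (fun=> series b N.+1) (fun n => series b (n + N.+1))).
  - exact: cvg_cst.
  - by rewrite (cvg_shiftn N.+1 (series b)).
  - move=> n; rewrite -subr_ge0; apply: le_trans (normr_ge0 _) _.
    by apply: (dist_majorized _ _ _ bS); exact: leq_addl.
(* One third each for the tail of [l], the first [J] terms and the tail of [a N]. *)
have -> : e = e / 3 + e / 3 + e / 3 by field.
rewrite -[limn _](subrK (series l J)) -addrA.
rewrite -[series l J - _](subrKA (\sum_(0 <= j < J) a N j)) addrA.
apply: le_trans (ler_normD _ _) _; apply: lerD aN.
apply: le_trans (ler_normD _ _) _; apply: lerD; first exact: le_trans bJ.
by near: N; move/cvgrPdist_le: aJ; apply.
Unshelve. all: by end_near.
Qed.

(** * Bounds for infinite products and for the majorant series *)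

Lemma expn_eventually_le (r e : K) : 0 <= r -> r < 1 -> 0 < e ->
  exists J, forall n, (J <= n)%N -> r ^+ n <= e.
Proof.
move=> r0 r1 e0.
have nr : `|r| < 1 by rewrite ger0_norm.
have /cvgrPdist_le/(_ e e0)[J _ hJ] := cvg_expn r nr.
exists J => n /hJ /=.
by rewrite sub0r normrN ger0_norm ?exprn_ge0.
Qed.

Lemma geometric_sum_le (r : K) n :
  0 <= r -> (1 - r) * (\sum_(k < n) r ^+ k) <= 1.
Proof.
by move=> r0; rewrite -opprB mulNr -subrX1 opprB gerBl exprn_ge0.
Qed.

(** By induction the product is at most 1 plus [2 * d] times the geometric sum; the choice of [d]
    keeps this below 2, which is what the next step needs. *)
Lemma prod_geometric_le2 (d r : K) n : 0 <= d -> 0 <= r -> r < 1 ->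
  d <= (1 - r) / 2 -> \prod_(k < n) (1 + d * r ^+ k) <= 2.
Proof.
move=> d0 r0 r1 dr.
have r10 : 0 < 1 - r by rewrite subr_gt0.
have geo m : 2 * d * (\sum_(k < m) r ^+ k) <= 1.
  apply: (@le_trans _ _ ((1 - r) * \sum_(k < m) r ^+ k)).
    apply: ler_wpM2r; first by rewrite sumr_ge0 // => k _; rewrite exprn_ge0.
    by rewrite mulrC -ler_pdivlMr.
  exact: geometric_sum_le.
suff /le_trans : \prod_(k < n) (1 + d * r ^+ k) <= 1 + 2 * d * \sum_(k < n) r ^+ k.
  by apply; rewrite -[2]/(1 + 1) lerD2l geo.
elim: n => [|n IHn]; first by rewrite !big_ord0 mulr0 addr0.
rewrite !big_ord_recr /= !mulrDr mulr1 addrA; apply: lerD => //.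
rewrite -mulrA ler_wpM2r ?mulr_ge0 ?exprn_ge0 //; apply: le_trans IHn _.
by rewrite -[2]/(1 + 1) lerD2l geo.
Qed.

Lemma prod_geometric_bounded (c r : K) : 0 <= c -> 0 <= r -> r < 1 ->
  exists E, forall n, \prod_(k < n) (1 + c * r ^+ k) <= E.
Proof.
move=> c0 r0 r1.
(* Past [J] the factors satisfy the smallness condition of [prod_geometric_le2]. Dividing by [1 + c]
   covers [c = 0]. *)
have e0 : 0 < (1 - r) / 2 / (1 + c).
  by rewrite !divr_gt0 ?subr_gt0 // ltr_pwDl.
have [J /(_ J (leqnn J)) hJ] := expn_eventually_le r _ r0 r1 e0.
have t1 k : 1 <= 1 + c * r ^+ k by rewrite lerDl mulr_ge0 ?exprn_ge0.
have p0 m : 0 <= \prod_(k < m) (1 + c * r ^+ k).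
  by apply: prodr_ge0 => k _; rewrite (le_trans ler01).
exists (2 * \prod_(k < J) (1 + c * r ^+ k)) => n.
apply: (@le_trans _ _ (\prod_(k < J + n) (1 + c * r ^+ k))).
  rewrite addnC; elim: J {hJ} => [|J IHJ]; first by rewrite addn0.
  by rewrite addnS big_ord_recr /= (le_trans IHJ) // ler_peMr.
rewrite big_split_ord /= [leLHS]mulrC; apply: ler_wpM2r; first exact: p0.
under eq_bigr do rewrite /= exprD mulrA.
apply: prod_geometric_le2 => //; first by rewrite mulr_ge0 ?exprn_ge0.
apply: (@le_trans _ _ ((1 + c) * r ^+ J)).
  by rewrite ler_wpM2r ?exprn_ge0 // lerDr.
by rewrite mulrC -ler_pdivlMr // ltr_pwDl.
Qed.

Lemma norm_qPochhammer_part (a q : K) n :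
  `|qPochhammer_part a q n| <= \prod_(k < n) (1 + `|a| * `|q| ^+ k).
Proof.
rewrite /qPochhammer_part normr_prod; apply: ler_prod => k _.
rewrite normr_ge0 /=; apply: le_trans (ler_normB _ _) _.
by rewrite normr1 normrM normrX.
Qed.

Lemma qPochhammer_partS (a q : K) n :
  qPochhammer_part a q n.+1 = qPochhammer_part a q n * (1 - a * q ^+ n).
Proof. by rewrite /qPochhammer_part big_ord_recr. Qed.

(** The majorant is the product with [a] and [q] replaced by their norms and minus by plus. *)
Lemma qPochhammer_cvgP (a q : K) : `|q| < 1 -> qPochhammer_cvg a q.
Proof.
move=> q1.
have [E hE] := prod_geometric_bounded _ _ (normr_ge0 a) (normr_ge0 q) q1.
apply: (majorized_cvg _ _ _ _ hE) => n.
rewrite qPochhammer_partS big_ord_recr /= mulrBr mulrDr !mulr1.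
rewrite addrAC subrr add0r normrN [leRHS]addrAC subrr add0r !normrM normrX.
by rewrite ler_wpM2r ?norm_qPochhammer_part // mulr_ge0 ?exprn_ge0.
Qed.

Lemma subr1_neq0 (x : K) : `|x| < 1 -> 1 - x != 0.
Proof.
by move=> x1; rewrite subr_eq0; apply: contraTneq x1 => <-; rewrite normr1 ltxx.
Qed.

Lemma normX_lt1 (x : K) n : `|x| < 1 -> `|x ^+ n.+1| < 1.
Proof. by move=> x1; rewrite normrX exprn_ilt1. Qed.

Lemma qPochhammer_part_neq0 (q : K) n : `|q| < 1 -> qPochhammer_part q q n != 0.
Proof.
move=> q1; apply/prodf_neq0 => k _.
by rewrite -exprS subr1_neq0 ?normX_lt1.
Qed.

(** The inverses of the partial products are bounded, since each inverse factor has norm at most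
    [1 + c * |q| ^+ k] with [c] the inverse of [1 - |q|]. Hence the limit stays away from 0. *)
Lemma qPochhammer_neq0 (q : K) : `|q| < 1 -> qPochhammer q q != 0.
Proof.
move=> q1.
have r10 : 0 < 1 - `|q| by rewrite subr_gt0.
have c0 : 0 <= (1 - `|q|)^-1 by rewrite invr_ge0 ltW.
have [E hE] := prod_geometric_bounded _ _ c0 (normr_ge0 q) q1.
have bound n : 1 <= `|qPochhammer_part q q n| * E.
  have Pn : 0 < `|qPochhammer_part q q n| by rewrite normr_gt0 qPochhammer_part_neq0.
  rewrite mulrC -ler_pdivrMr // div1r; apply: le_trans (hE n).
  rewrite /qPochhammer_part -normfV -prodfV normr_prod.
  apply: ler_prod => k _; rewrite normr_ge0 /= -exprS.
  have y1 : `|q ^+ k.+1| < 1 by exact: normX_lt1.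
  have yr : `|q ^+ k.+1| <= `|q| by rewrite normrX exprS ler_piMr // exprn_ile1 // ltW.
  have yk : `|q ^+ k.+1| <= `|q| ^+ k.
    by rewrite normrX exprS ler_piMl ?exprn_ge0 // ltW.
  have y0 := subr1_neq0 _ y1.
  have -> : (1 - q ^+ k.+1)^-1 = 1 + (1 - q ^+ k.+1)^-1 * q ^+ k.+1.
    by move: (q ^+ k.+1) y0 => y y0; field.
  apply: le_trans (ler_normD _ _) _; rewrite normr1 lerD2l normrM.
  apply: ler_pM => //; rewrite normfV lef_pV2 ?posrE ?normr_gt0 //.
  apply: le_trans (lerB_dist _ _); rewrite normr1 lerD2l lerN2 //.
have lim1 : 1 <= `|qPochhammer q q| * E.
  apply: (@cvg_le _ (fun=> 1) (fun n => `|qPochhammer_part q q n| * E)) bound.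
    exact: cvg_cst.
  by apply: cvgM (cvg_cst E); apply: cvg_norm; exact: qPochhammer_cvgP.
apply: contraTneq lim1 => ->; rewrite normr0 mul0r.
by rewrite -subr_ge0 sub0r oppr_ge0 ler10.
Qed.

Lemma sum_superexp_bounded (r : K) : 0 <= r -> r < 1 ->
  exists B, forall n,
    \sum_(0 <= j < n) j%:R * 2 ^+ (2 * j) * r ^+ 'C(2 * j, 2) <= B.
Proof.
move=> r0 r1.
(* The exponent is [(2j - 1) * j], so eventually the power of [r] is at most [16 ^- j]. As
   [j <= 2 ^ j], the term times [2 ^ j] is then at most 1, and [d] is dominated by a geometric
   series. *)
have e0 : 0 < 16^-1 :> K by rewrite invr_gt0.
have [J hJ] := expn_eventually_le r _ r0 r1 e0.
pose d j : K := j%:R * 2 ^+ (2 * j) * r ^+ 'C(2 * j, 2).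
have d0 j : 0 <= d j by rewrite !mulr_ge0 ?exprn_ge0.
(* The sum covers the indices up to [J], the 1 all later ones. *)
pose D := 1 + \sum_(i < J.+1) d i * 2 ^+ i.
have D0 : 0 <= D.
  by rewrite addr_ge0 // sumr_ge0 // => i _; rewrite mulr_ge0 ?exprn_ge0.
have dD j : d j * 2 ^+ j <= D.
  have [jJ|Jj] := ltnP j J.+1.
    rewrite /D (bigD1 (Ordinal jJ)) //= addrCA lerDl addr_ge0 // sumr_ge0 //.
    by move=> i _; rewrite mulr_ge0 ?exprn_ge0.
  apply: (@le_trans _ _ 1); last first.
    by rewrite lerDl sumr_ge0 // => i _; rewrite mulr_ge0 ?exprn_ge0.
  have binE : 'C(2 * j, 2) = ((2 * j).-1 * j)%N.
    by rewrite bin2 mulnC mulnCA mul2n doubleK mulnC.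
  have rj : r ^+ 'C(2 * j, 2) <= (2 ^+ (4 * j))^-1.
    rewrite binE exprM exprM -exprVn lerXn2r ?nnegrE ?exprn_ge0 ?invr_ge0 //.
    have -> : 2 ^+ 4 = 16 :> K by ring.
    apply: hJ; apply: (leq_trans (ltnW Jj)).
    by case: j {binE} Jj => // j _; rewrite mul2n doubleS /= -addnn -addSn leq_addr.
  have jj : j%:R <= 2 ^+ j :> K by rewrite -natrX ler_nat ltnW // ltn_expl.
  apply: (@le_trans _ _ (2 ^+ j * 2 ^+ (2 * j) * (2 ^+ (4 * j))^-1 * 2 ^+ j)).
    rewrite ler_wpM2r ?exprn_ge0 //.
    by apply: ler_pM; rewrite ?mulr_ge0 ?ler_wpM2r ?exprn_ge0.
  have -> : (4 * j = j + 2 * j + j)%N by rewrite -[4%N]/(1 + 2 + 1)%N !mulnDl !mul1n.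
  rewrite !exprD mulrAC divff // !mulf_neq0 ?expf_neq0 //; exact: pnatr_eq0.
exists (D * 2) => n.
apply: (@le_trans _ _ (D * \sum_(0 <= j < n) (2^-1) ^+ j)).
  rewrite mulr_sumr; apply: ler_sum => j _.
  by rewrite exprVn ler_pdivlMr ?exprn_gt0 ?ltr0n //; exact: dD.
rewrite ler_wpM2l // big_mkord.
have half : 1 - 2^-1 = 2^-1 :> K by field.
have := geometric_sum_le (2^-1) n; rewrite half invr_ge0 ler0n => /(_ isT).
by rewrite ler_pdivrMl // mulr1.
Qed.

(** * Letting the multiplicities, then the parts, become unbounded *)

Implicit Types x q : K.

Lemma cvg_geometric_sum x : `|x| < 1 ->
  (fun n => \sum_(0 <= b < n.+1) x ^+ b) @ \oo --> (1 - x)^-1.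
Proof.
move=> x1; have x0 := subr1_neq0 _ x1.
have -> : (fun n => \sum_(0 <= b < n.+1) x ^+ b) =
    (fun n => (1 - x ^+ n.+1) * (1 - x)^-1).
  apply/funext => n; rewrite big_mkord -(opprB _ 1) subrX1 -mulNr opprB.
  by rewrite mulrC mulKf.
rewrite -[X in _ --> X]mul1r; apply: cvgM (cvg_cst _).
rewrite -[X in _ --> X]subr0; apply: cvgB (cvg_cst _) _.
rewrite (cvg_shiftS (fun n => x ^+ n)); exact: cvg_expn.
Qed.

Definition mex_factor x i k : K :=
  let y := x ^+ k.+1 in
  if (k.+1 < i)%N then 2 * y / (1 - y)
  else if k.+1 == i then 1 else (1 + y) / (1 - y).

Definition mex_parts x N : K :=
  \sum_(j < N.+1 | (2 * j <= N)%N)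
     (2 * j)%:R * \prod_(k < N) mex_factor x (2 * j) k.

Lemma cvg_mex_poly x N : `|x| < 1 ->
  (fun M => mex_poly N M K x) @ \oo --> mex_parts x N.
Proof.
move=> x1; under eq_fun do rewrite mex_polyE.
apply: cvg_big => [|j _]; first exact: add_continuous.
apply: cvgM; first exact: cvg_cst.
apply: cvg_big => [|k _]; first exact: mul_continuous.
under eq_fun do rewrite sum_mex_ok.
have y1 := normX_lt1 x k x1; rewrite /mex_factor.
have y0 := subr1_neq0 _ y1.
have ch : (fun M => (1 + x ^+ k.+1) * \sum_(0 <= b < M.+1) (x ^+ k.+1) ^+ b)
    @ \oo --> (1 + x ^+ k.+1) / (1 - x ^+ k.+1).
  by apply: cvgM; [exact: cvg_cst|exact: cvg_geometric_sum].
case: ifP => _ /=; last by case: ifP => // _; exact: cvg_cst.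
have -> : 2 * x ^+ k.+1 / (1 - x ^+ k.+1) = (1 + x ^+ k.+1) / (1 - x ^+ k.+1) - 1.
  by move: (x ^+ k.+1) y0 => y y0; field.
exact: cvgB ch (cvg_cst _).
Qed.

Lemma prod_double_expr x n :
  \prod_(0 <= k < n) (2 * x ^+ k.+1) = 2 ^+ n * x ^+ 'C(n.+1, 2).
Proof.
elim: n => [|n IHn]; first by rewrite big_nil mul1r.
by rewrite big_nat_recr //= IHn mulrACA -exprSr -exprD [in RHS]binS bin1.
Qed.

(** All denominators are pulled out. The absent part [i + 1] has none, whence the compensating
    [1 - x ^+ i.+1]; the parts below it yield the exponent [1 + ... + i]. *)
Lemma prod_mex_factor x N i : `|x| < 1 -> (i < N)%N ->
  \prod_(k < N) mex_factor x i.+1 k =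
  (qPochhammer_part x x N)^-1 *
  (2 ^+ i * x ^+ 'C(i.+1, 2) * qPochhammer_part (- x ^+ i.+2) x (N - i.+1)
   * (1 - x ^+ i.+1)).
Proof.
move=> x1 iN.
have y0 k : 1 - x ^+ k.+1 != 0 by rewrite subr1_neq0 ?normX_lt1.
have -> : \prod_(k < N) mex_factor x i.+1 k = (qPochhammer_part x x N)^-1 *
    \prod_(0 <= k < N) (if (k < i)%N then 2 * x ^+ k.+1 else
       if k == i then 1 - x ^+ k.+1 else 1 + x ^+ k.+1).
  rewrite /qPochhammer_part -prodfV big_mkord -big_split /=.
  apply: eq_bigr => k _; rewrite -exprS /mex_factor ltnS eqSS.
  case: ifP => _; first by rewrite [LHS]mulrC.
  by case: ifP => _; [rewrite mulVf|rewrite [LHS]mulrC].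
congr (_ * _); rewrite (big_cat_nat _ (n := i)) //=; last exact: ltnW.
rewrite (big_ltn iN) ltnn eqxx.
rewrite (eq_big_nat _ _ (F2 := fun k => 2 * x ^+ k.+1)); last first.
  by move=> k /andP[_ ->].
rewrite prod_double_expr -[RHS]mulrA [X in _ = _ * X]mulrC; congr (_ * (_ * _)).
rewrite -{1}[i.+1]add0n big_addn /qPochhammer_part big_mkord.
apply: eq_bigr => k _; rewrite addnS ltnNge leqW ?leq_addl //=.
rewrite gtn_eqF ?ltnS ?leq_addl //.
by rewrite mulNr opprK -exprD addnC !addSn.
Qed.

Definition mex_term x (j : nat) : K :=
  j%:R * 2 ^+ (2 * j) * x ^+ 'C(2 * j, 2)
  * qPochhammer (- x ^+ (2 * j + 1)) x * (1 - x ^+ (2 * j)).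

Definition mex_sum x : K := 1 / qPochhammer x x * limn (series (mex_term x)).

(** The term [mex_term x j] with parts cut at [N], extended by 0 so that [tannery] applies. *)
Definition mex_term_part x (N j : nat) : K :=
  if (2 * j <= N)%N then
    j%:R * 2 ^+ (2 * j) * x ^+ 'C(2 * j, 2)
    * qPochhammer_part (- x ^+ (2 * j + 1)) x (N - 2 * j) * (1 - x ^+ (2 * j))
  else 0.

Lemma mex_partsE x N : `|x| < 1 ->
  mex_parts x N =
  1 / qPochhammer_part x x N * \sum_(j < N.+1) mex_term_part x N j.
Proof.
move=> x1; rewrite /mex_parts mulr_sumr big_mkcond /=; apply: eq_bigr => j _.
rewrite /mex_term_part; case: ifP => jN; last by rewrite mulr0.
case: (posnP j) => [->|j0]; first by rewrite !mul0r mulr0.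
have [i iE] : exists i, (2 * j = i.+1)%N.
  by exists (2 * j).-1; rewrite prednK // muln_gt0.
(* Only the [2j - 1] parts below the mex carry a factor 2; the missing one comes from the weight
   [2j]. *)
have jE : (2 * j)%:R * 2 ^+ i = j%:R * 2 ^+ (2 * j) :> K.
  by rewrite {2}iE exprS natrM mulrCA mulrA.
rewrite -jE iE in jN *; rewrite prod_mex_factor // addn1 div1r.
rewrite mulrCA; congr (_ * _); by rewrite !mulrA.
Qed.

Lemma cvg_mex_parts x : `|x| < 1 ->
  cvgn (series (mex_term x)) /\
  mex_parts x @ \oo --> mex_sum x.
Proof.
move=> x1.
have [E hE] := prod_geometric_bounded 1 `|x| ler01 (normr_ge0 x) x1.
have [B hB] := sum_superexp_bounded _ (normr_ge0 x) x1.
have E0 : 0 <= E by have := hE 0%N; rewrite big_ord0; apply: le_trans.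
(* [E] bounds the truncated Pochhammer factor uniformly, and 2 bounds [1 - x ^+ (2 * j)] in norm. *)
pose b j : K := j%:R * 2 ^+ (2 * j) * `|x| ^+ 'C(2 * j, 2) * (E * 2).
have ab N j : `|mex_term_part x N j| <= b j.
  rewrite /mex_term_part; case: ifP => _; last first.
    by rewrite normr0 !mulr_ge0 ?exprn_ge0.
  rewrite !normrM !normrX !normr_nat -mulrA ler_wpM2l ?mulr_ge0 ?exprn_ge0 //.
  apply: ler_pM => //.
    apply: le_trans (norm_qPochhammer_part _ _ _) (le_trans _ (hE (N - 2 * j)%N)).
    apply: ler_prod => k _; rewrite addr_ge0 ?mulr_ge0 ?exprn_ge0 //= lerD2l.
    by rewrite ler_wpM2r ?exprn_ge0 // normrN normrX exprn_ile1 // ltW.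
  apply: le_trans (ler_normB _ _) _; rewrite normr1 -[2]/(1 + 1) lerD2l.
  by rewrite normrX exprn_ile1 // ltW.
have al j : (mex_term_part x)^~ j @ \oo --> mex_term x j.
  (* Shifting [N] by [2 * j] makes the test true and the Pochhammer length equal to the new
     index. *)
  rewrite -(cvg_shiftn (2 * j)) /mex_term_part /=.
  under eq_fun do rewrite leq_addl addnK.
  apply: cvgM (cvg_cst _); apply: cvgM; first exact: cvg_cst.
  exact: qPochhammer_cvgP.
have bB n : series b n <= B * (E * 2).
  by rewrite /series /= -mulr_suml ler_wpM2r // mulr_ge0.
have [cs cl] := tannery _ _ _ _ ab al bB.
split=> //; rewrite (_ : mex_parts x = fun N => 1 / qPochhammer_part x x N *
    \sum_(j < N.+1) mex_term_part x N j); last first.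
  by apply/funext => N; exact: mex_partsE.
apply: cvgM cl; apply: cvgM; first exact: cvg_cst.
by apply: cvgV; [exact: qPochhammer_neq0|exact: qPochhammer_cvgP].
Qed.

(** * Convergence of the series to the product side *)

(** The bound of [mex_poly_dist] survives both limits; shifting [M] and [N] by [D] keeps its
    hypotheses valid throughout. *)
Lemma series_mex_dist x D : `|x| < 1 ->
  `|mex_sum x - series (fun n => (sigma_eMex n)%:R * x ^+ n) D| <=
  mex_sum `|x| - series (fun n => (sigma_eMex n)%:R * `|x| ^+ n) D.
Proof.
move=> x1.
have nx1 : `| `|x| | < 1 by rewrite normr_id.
have step N : (D <= N)%N ->
  `|mex_parts x N - series (fun n => (sigma_eMex n)%:R * x ^+ n) D| <=
  mex_parts `|x| N - series (fun n => (sigma_eMex n)%:R * `|x| ^+ n) D.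
  move=> DN.
  apply: (@cvg_le _
    (fun M => `|mex_poly N (M + D) K x -
       series (fun n => (sigma_eMex n)%:R * x ^+ n) D|)
    (fun M => mex_poly N (M + D) K `|x| -
       series (fun n => (sigma_eMex n)%:R * `|x| ^+ n) D)).
  - apply: cvg_norm; apply: cvgB (cvg_cst _).
    rewrite (cvg_shiftn D (fun M => mex_poly N M K x)); exact: cvg_mex_poly.
  - apply: cvgB (cvg_cst _).
    rewrite (cvg_shiftn D (fun M => mex_poly N M K `|x|)); exact: cvg_mex_poly.
  - by move=> M; apply: mex_poly_dist => //; exact: leq_addl.
apply: (@cvg_le _
    (fun N => `|mex_parts x (N + D) -
       series (fun n => (sigma_eMex n)%:R * x ^+ n) D|)
    (fun N => mex_parts `|x| (N + D) -
       series (fun n => (sigma_eMex n)%:R * `|x| ^+ n) D)).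
- apply: cvg_norm; apply: cvgB (cvg_cst _).
  by rewrite (cvg_shiftn D (mex_parts x)); exact: (cvg_mex_parts _ _).2.
- apply: cvgB (cvg_cst _).
  by rewrite (cvg_shiftn D (mex_parts `|x|)); exact: (cvg_mex_parts _ _).2.
- by move=> N; apply: step; exact: leq_addl.
Qed.

(** By [series_mex_dist] it suffices that the series at the norm of [x] sums to [mex_sum] there. *)
Lemma cvg_series_mex x : `|x| < 1 ->
  series (fun n => (sigma_eMex n)%:R * x ^+ n) @ \oo --> mex_sum x.
Proof.
move=> x1.
have nx1 : `| `|x| | < 1 by rewrite normr_id.
pose L := series (fun n => (sigma_eMex n)%:R * `|x| ^+ n).
pose S := mex_sum `|x|.
have LS n : L n <= S.
  by rewrite -subr_ge0; apply: le_trans (series_mex_dist _ n x1).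
have LD n : `|L n.+1 - L n| <= L n.+1 - L n.
  by rewrite seriesSB ger0_norm // mulr_ge0 ?exprn_ge0.
have cL : cvgn L := majorized_cvg _ _ _ LD LS.
have Ll n : L n <= limn L.
  apply: (@cvg_le _ (fun=> L n) (fun m => L (m + n)%N)); first exact: cvg_cst.
    by rewrite (cvg_shiftn n L).
  move=> m; rewrite -subr_ge0; apply: le_trans (normr_ge0 _) _.
  by apply: (dist_majorized _ _ _ LD); exact: leq_addl.
(* The partial sums are below [S]; conversely each [mex_poly] is below some partial sum, hence so is
   its double limit [S] below the limit of [L]. *)
have lS : limn L = S.
  apply/eqP; rewrite eq_le; apply/andP; split.
    by apply: (@cvg_le _ L (fun=> S)) cL _ LS; exact: cvg_cst.
  apply: (@cvg_le _ (mex_parts `|x|) (fun=> limn L)).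
  - exact: (cvg_mex_parts _ nx1).2.
  - exact: cvg_cst.
  move=> N; apply: (@cvg_le _ (fun M => mex_poly N M K `|x|) (fun=> limn L)).
  - exact: cvg_mex_poly.
  - exact: cvg_cst.
  move=> M; have [D /le_trans] := mex_poly_le N M K _ (normr_ge0 x).
  by apply; exact: Ll.
apply: (@cvg_dist_le _ _ (fun n => S - L n)); last first.
  by move=> n; exact: series_mex_dist.
rewrite [X in _ --> X](_ : 0 = S - limn L); last by rewrite lS subrr.
by apply: cvgB cL; exact: cvg_cst.
Qed.

End MajorizedComplete.

Local Close Scope classical_set_scope.

Theorem theorem1p5 (R : realType) (q : R[i]) (hq : `|q| < 1) :
  let lhs := fun n : nat => (sigma_eMex n)%:R * q ^+ n in
  let rhs := fun j : nat =>
    j%:R * 2 ^+ (2 * j) * q ^+ 'C(2 * j, 2)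
    * qPochhammer (- q ^+ (2 * j + 1)) q * (1 - q ^+ (2 * j)) in
  [/\ qPochhammer_cvg q q /\ qPochhammer q q != 0,
      forall j : nat, qPochhammer_cvg (- q ^+ (2 * j + 1)) q,
      series_cvg lhs, series_cvg rhs
    & series_sum lhs = 1 / qPochhammer q q * series_sum rhs].
Proof.
move=> lhs rhs.
have Kc := complex_majorized_complete R.
have cl := cvg_series_mex _ Kc q hq.
split.
- by split; [exact: qPochhammer_cvgP|exact: qPochhammer_neq0].
- by move=> j; exact: qPochhammer_cvgP.
- by apply/cvg_ex; exists (1 / qPochhammer q q * series_sum rhs).
- exact: (cvg_mex_parts _ Kc q hq).1.
- exact: (cvg_lim (@norm_hausdorff _ _) cl).
Qed.
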